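(* Let $\mathbb{G}$ be a compact quantum group of Kac type, $\mathcal{A}=\mathrm{Pol}(\mathbb{G})$ and $\mathcal{A}^{\mathrm{cop}}=\mathrm{Pol}(\mathbb{G}^{\mathrm{cop}})$. The formula \[\phi_D(a \otimes \widetilde{b}) = h(a\,S(b)), \qquad a, b \in \mathcal{A},\] defines (by linear extension) an idempotent state on $\mathcal{A} \odot \mathcal{A}^{\mathrm{cop}}$.
   Context: $\mathrm{Pol}(\mathbb{G})$ is the Hopf $*$-algebra of the compact quantum group $\mathbb{G}$, with coproduct $\Delta$, antipode $S$ and Haar state $h$. $\mathbb{G}$ is of Kac type if $h$ is a trace. $\mathbb{G}^{\mathrm{cop}}$ is the compact quantum group obtained from $\mathbb{G}$ by keeping the $*$-algebra and replacing $\Delta$ by $\Sigma\circ\Delta$, $\Sigma$ being the tensor flip; $\widetilde{\ }:\mathcal{A}\to\mathcal{A}^{\mathrm{cop}}$ denotes the formal identity map. The algebraic tensor product $\mathcal{A}\odot\mathcal{A}^{\mathrm{cop}}$ is the Hopf $*$-algebra $\mathrm{Pol}(\mathbb{G}\times\mathbb{G}^{\mathrm{cop}})$, with coproduct $\Delta^{\iota,\mathrm{cop}}(a\otimes\widetilde b)=a_{(1)}\otimes\widetilde{b_{(2)}}\otimes a_{(2)}\otimes\widetilde{b_{(1)}}$ (Sweedler notation $\Delta(a)=a_{(1)}\otimes a_{(2)}$). A state on such an algebra is a unital functional that is non-negative on all $x^*x$; it is idempotent if $(\phi\otimes\phi)\circ\Delta^{\iota,\mathrm{cop}}=\phi$.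 *)

(* Defs.v *)
From HB Require Import structures.
From mathcomp Require Import all_boot all_order all_algebra sesquilinear.
From mathcomp Require Import boolp classical_sets reals complex.

Set Implicit Arguments.
Unset Strict Implicit.
Unset Printing Implicit Defensive.

Import Order.TTheory GRing.Theory Num.Theory.
Local Open Scope ring_scope.
Local Open Scope quotient_scope.

Reserved Notation "V ⊙ W" (at level 40, left associativity).
Reserved Notation "v ⊗ w" (at level 40, left associativity).

(* The algebraic tensor product: formal sums of pairs, two of them being
   identified when every bilinear map takes the same value on both. *)

Section Tensor.
Variables (K : nzRingType) (V W : lmodType K).

Definition formal_eval (U : lmodType K) (f : V -> W -> U) (s : seq (V * W)) : U :=
  \sum_(p <- s) f p.1 p.2.

Definition formal_eq (s t : seq (V * W)) : bool :=
  `[< forall (U : lmodType K) (f : {bilinear V -> W -> U}),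
        formal_eval f s = formal_eval f t >].

Lemma formal_eq_refl : reflexive formal_eq.
Proof. by move=> s; apply/asboolP. Qed.

Lemma formal_eq_sym : symmetric formal_eq.
Proof. by move=> s t; apply/asboolP/asboolP => h U f; rewrite h. Qed.

Lemma formal_eq_trans : transitive formal_eq.
Proof. by move=> s t u /asboolP h1 /asboolP h2; apply/asboolP => U f; rewrite h1. Qed.

Canonical formal_eq_equiv :=
  EquivRel formal_eq formal_eq_refl formal_eq_sym formal_eq_trans.

Definition tens : Type := {eq_quot formal_eq}.
HB.instance Definition _ := Choice.on tens.
HB.instance Definition _ := EqQuotient.on tens.

Definition tens_lift (U : lmodType K) (f : V -> W -> U) (x : tens) : U :=
  formal_eval f (repr x).

Definition pure_tens (v : V) (w : W) : tens := \pi_tens [:: (v, w)].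

Lemma tens_lift_pi (U : lmodType K) (f : {bilinear V -> W -> U}) s :
  tens_lift f (\pi_tens s) = formal_eval f s.
Proof.
rewrite /tens_lift; case: piP => t /eqmodP /asboolP h.
by rewrite h.
Qed.

Lemma tens_eqP (x y : tens) :
  (forall (U : lmodType K) (f : {bilinear V -> W -> U}),
     tens_lift f x = tens_lift f y) -> x = y.
Proof.
move=> h; rewrite -[x]reprK -[y]reprK; apply/eqmodP/asboolP => U f; exact: h.
Qed.

Definition tens_zero : tens := \pi_tens [::].
Definition tens_add (x y : tens) : tens := \pi_tens (repr x ++ repr y).
Definition tens_scale (k : K) (x : tens) : tens :=
  \pi_tens [seq (k *: p.1, p.2) | p <- repr x].
Definition tens_opp (x : tens) : tens := tens_scale (-1) x.

Lemma tens_lift_zero (U : lmodType K) (f : {bilinear V -> W -> U}) :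
  tens_lift f tens_zero = 0.
Proof. by rewrite tens_lift_pi /formal_eval big_nil. Qed.

Lemma tens_lift_add (U : lmodType K) (f : {bilinear V -> W -> U}) x y :
  tens_lift f (tens_add x y) = tens_lift f x + tens_lift f y.
Proof. by rewrite tens_lift_pi /formal_eval big_cat. Qed.

Lemma tens_lift_scale (U : lmodType K) (f : {bilinear V -> W -> U}) k x :
  tens_lift f (tens_scale k x) = k *: tens_lift f x.
Proof.
rewrite tens_lift_pi /formal_eval big_map /= scaler_sumr.
by apply: eq_bigr => p _; rewrite linearZl_LR.
Qed.

Let addE := (tens_lift_add, tens_lift_zero, tens_lift_scale).

Fact tens_addA : associative tens_add.
Proof. by move=> x y z; apply: tens_eqP => U f; rewrite !addE addrA. Qed.
Fact tens_addC : commutative tens_add.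
Proof. by move=> x y; apply: tens_eqP => U f; rewrite !addE addrC. Qed.
Fact tens_add0 : left_id tens_zero tens_add.
Proof. by move=> x; apply: tens_eqP => U f; rewrite !addE add0r. Qed.
Fact tens_addN : left_inverse tens_zero tens_opp tens_add.
Proof. by move=> x; apply: tens_eqP => U f; rewrite !addE scaleN1r addNr. Qed.

HB.instance Definition _ :=
  GRing.isZmodule.Build tens tens_addA tens_addC tens_add0 tens_addN.

Let tens_liftD (U : lmodType K) (f : {bilinear V -> W -> U}) (x y : tens) :
  tens_lift f (x + y) = tens_lift f x + tens_lift f y.
Proof. exact: tens_lift_add. Qed.
Let addE' := (tens_liftD, tens_lift_scale).

Fact tens_scaleA a b (x : tens) :
  tens_scale a (tens_scale b x) = tens_scale (a * b) x.
Proof. by apply: tens_eqP => U f; rewrite !addE scalerA. Qed.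
Fact tens_scale1 : left_id 1 tens_scale.
Proof. by move=> x; apply: tens_eqP => U f; rewrite !addE scale1r. Qed.
Fact tens_scaleDr : right_distributive tens_scale +%R.
Proof. by move=> a x y; apply: tens_eqP => U f; rewrite !addE' scalerDr. Qed.
Fact tens_scaleDl (x : tens) :
  {morph tens_scale^~ x : a b / a + b}.
Proof. by move=> a b; apply: tens_eqP => U f; rewrite !addE' scalerDl. Qed.

HB.instance Definition _ := GRing.Zmodule_isLmodule.Build K tens
  tens_scaleA tens_scale1 tens_scaleDr tens_scaleDl.

Lemma tens_lift_linear (U : lmodType K) (f : {bilinear V -> W -> U}) :
  linear (tens_lift f).
Proof.
by move=> a x y; rewrite [LHS]tens_lift_add [X in X + _]tens_lift_scale.
Qed.
HB.instance Definition _ (U : lmodType K) (f : {bilinear V -> W -> U}) :=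
  GRing.isLinear.Build K tens U *:%R (tens_lift f) (tens_lift_linear f).

Local Notation "v ⊗ w" := (pure_tens v w).

Lemma tens_liftE (U : lmodType K) (f : {bilinear V -> W -> U}) v w :
  tens_lift f (v ⊗ w) = f v w.
Proof. by rewrite tens_lift_pi /formal_eval big_seq1. Qed.

Lemma pure_tensDl v v' w : (v + v') ⊗ w = v ⊗ w + v' ⊗ w.
Proof. by apply: tens_eqP => U f; rewrite raddfD /= !tens_liftE linearDl. Qed.
Lemma pure_tensDr v w w' : v ⊗ (w + w') = v ⊗ w + v ⊗ w'.
Proof. by apply: tens_eqP => U f; rewrite raddfD /= !tens_liftE linearDr. Qed.
Lemma pure_tensZl k v w : (k *: v) ⊗ w = k *: (v ⊗ w).
Proof. by apply: tens_eqP => U f; rewrite linearZ /= !tens_liftE linearZl_LR. Qed.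
Lemma pure_tensZr k v w : v ⊗ (k *: w) = k *: (v ⊗ w).
Proof. by apply: tens_eqP => U f; rewrite linearZ /= !tens_liftE linearZr_LR. Qed.

Fact pure_tens_bilinear : bilinear_for *:%R *:%R pure_tens.
Proof.
split=> [w|v] k x y /=.
  by rewrite pure_tensDl pure_tensZl.
by rewrite pure_tensDr pure_tensZr.
Qed.
HB.instance Definition _ :=
  bilinear_isBilinear.Build K V W tens *:%R *:%R pure_tens pure_tens_bilinear.

Fact pure_tens_linear v : linear (pure_tens v).
Proof. by move=> k w w'; rewrite pure_tensDr pure_tensZr. Qed.
HB.instance Definition _ v :=
  GRing.isLinear.Build K W tens *:%R (pure_tens v) (pure_tens_linear v).

Lemma tens_sum_pure (x : tens) : exists s : seq (V * W),
  x = \sum_(p <- s) p.1 ⊗ p.2.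
Proof.
exists (repr x); apply: tens_eqP => U f; rewrite raddf_sum /=.
by apply: eq_bigr => p _; rewrite tens_liftE.
Qed.

Lemma tens_ind (P : tens -> Prop) :
  (forall v w, P (v ⊗ w)) -> (forall x y, P x -> P y -> P (x + y)) ->
  forall x, P x.
Proof.
move=> Pp PD x; have [s ->] := tens_sum_pure x.
elim: s => [|p s IH]; last by rewrite big_cons; apply: PD.
by rewrite big_nil -(scale0r (0 ⊗ 0)) -pure_tensZl; apply: Pp.
Qed.

End Tensor.

(* Keeps unification from unfolding the quotient construction. *)
#[global] Opaque tens.

Notation "V ⊙ W" := (tens V W) : type_scope.
Notation "v ⊗ w" := (pure_tens v w) : ring_scope.

Section TensorMaps.
Variable K : comNzRingType.
Implicit Types U V W X : lmodType K.

Local Notation bilin := (bilinear_for *:%R *:%R).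

Lemma tens_lift_is_linear V W U (f : V -> W -> U) :
  bilin f -> linear (tens_lift f).
Proof.
move=> hf; pose b := bilinear_isBilinear.Build K V W U *:%R *:%R f hf.
pose F : {bilinear V -> W -> U} := HB.pack f b.
exact: (@tens_lift_linear _ _ _ _ F).
Qed.

Lemma tens_lift_pure V W U (f : V -> W -> U) v w :
  bilin f -> tens_lift f (v ⊗ w) = f v w.
Proof.
move=> hf; pose b := bilinear_isBilinear.Build K V W U *:%R *:%R f hf.
pose F : {bilinear V -> W -> U} := HB.pack f b.
exact: (@tens_liftE _ _ _ _ F).
Qed.

Lemma tens_ext V W U (f g : {linear V ⊙ W -> U}) :
  (forall v w, f (v ⊗ w) = g (v ⊗ w)) -> f =1 g.
Proof.
by move=> h; apply: tens_ind => [//|x y hx hy]; rewrite !raddfD /= hx hy.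
Qed.

Definition tens_map V W X U (f : V -> X) (g : W -> U) : V ⊙ W -> X ⊙ U :=
  tens_lift (fun v w => f v ⊗ g w).

Section MapTheory.
Variables (V W X U : lmodType K) (f : {linear V -> X}) (g : {linear W -> U}).

Fact tens_map_bilin : bilin (fun v w => f v ⊗ g w).
Proof.
split=> [w|v] k x y /=; rewrite linearP.
  by rewrite pure_tensDl pure_tensZl.
by rewrite pure_tensDr pure_tensZr.
Qed.

HB.instance Definition _ := GRing.isLinear.Build K (V ⊙ W) (X ⊙ U) *:%R
  (tens_map f g) (tens_lift_is_linear tens_map_bilin).

Lemma tens_mapE v w : tens_map f g (v ⊗ w) = f v ⊗ g w.
Proof. exact: tens_lift_pure tens_map_bilin. Qed.
End MapTheory.

Definition tens_swap V W : V ⊙ W -> W ⊙ V := tens_lift (fun v w => w ⊗ v).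

Section SwapTheory.
Variables V W : lmodType K.
Fact tens_swap_bilin : bilin (fun (v : V) (w : W) => w ⊗ v).
Proof.
by split=> [w|v] k x y /=; rewrite ?pure_tensDl ?pure_tensDr ?pure_tensZr ?pure_tensZl.
Qed.
HB.instance Definition _ := GRing.isLinear.Build K (V ⊙ W) (W ⊙ V) *:%R
  (@tens_swap V W) (tens_lift_is_linear tens_swap_bilin).
Lemma tens_swapE v w : @tens_swap V W (v ⊗ w) = w ⊗ v.
Proof. exact: tens_lift_pure tens_swap_bilin. Qed.
End SwapTheory.

Definition tens_assoc U V W : (U ⊙ V) ⊙ W -> U ⊙ (V ⊙ W) :=
  tens_lift (fun x w => tens_lift (fun u v => u ⊗ (v ⊗ w)) x).

Section AssocTheory.
Variables U V W : lmodType K.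
Fact tens_assoc_bilin1 w : bilin (fun (u : U) (v : V) => u ⊗ (v ⊗ w : V ⊙ W)).
Proof.
by split=> [v|u] k x y /=; rewrite ?(pure_tensDl, pure_tensDr, pure_tensZr, pure_tensZl).
Qed.
Fact tens_assoc_bilin :
  bilin (fun (x : U ⊙ V) (w : W) => tens_lift (fun u v => u ⊗ (v ⊗ w)) x).
Proof.
split=> [w|x] k.
  exact: tens_lift_is_linear (tens_assoc_bilin1 w) k.
move=> w w'; elim/tens_ind: x => [u v|x y /= hx hy].
  rewrite /= !tens_lift_pure; try exact: tens_assoc_bilin1.
  by rewrite ?(pure_tensDl, pure_tensDr, pure_tensZr, pure_tensZl).
have lin z x' y' := tens_lift_is_linear (tens_assoc_bilin1 z) 1 x' y'.
move: (lin (k *: w + w') x y) (lin w x y) (lin w' x y); rewrite !scale1r /= => -> -> ->.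
by rewrite hx hy scalerDr addrACA.
Qed.
HB.instance Definition _ := GRing.isLinear.Build K ((U ⊙ V) ⊙ W) (U ⊙ (V ⊙ W)) *:%R
  (@tens_assoc U V W) (tens_lift_is_linear tens_assoc_bilin).
Lemma tens_assocE u v w : @tens_assoc U V W ((u ⊗ v) ⊗ w) = u ⊗ (v ⊗ w).
Proof.
rewrite /tens_assoc tens_lift_pure; last exact: tens_assoc_bilin.
exact: tens_lift_pure (tens_assoc_bilin1 w).
Qed.
End AssocTheory.

(* (u ⊗ v) ⊗ (w ⊗ x) |-> (u ⊗ w) ⊗ (v ⊗ x) *)
Definition tens_shuffle U V W X : (U ⊙ V) ⊙ (W ⊙ X) -> (U ⊙ W) ⊙ (V ⊙ X) :=
  tens_lift (fun p q => tens_lift (fun u v => tens_map (pure_tens u) (pure_tens v) q) p).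

Section ShuffleTheory.
Variables U V W X : lmodType K.
Let inner (q : W ⊙ X) := fun (u : U) (v : V) => tens_map (pure_tens u) (pure_tens v) q.
Fact tens_shuffle_bilin1 q : bilin (inner q).
Proof.
rewrite /inner; split=> [v|u] k x y /=; elim/tens_ind: q => [w z|p q hp hq].
- by rewrite !tens_mapE /= pure_tensDl pure_tensZl pure_tensDl pure_tensZl.
- by rewrite !raddfD /= hp hq addrACA.
- by rewrite !tens_mapE /= pure_tensDl pure_tensZl pure_tensDr pure_tensZr.
- by rewrite !raddfD /= hp hq addrACA.
Qed.
Fact tens_shuffle_bilin : bilin (fun p q => tens_lift (inner q) p).
Proof.
split=> [q|p] k; first exact: tens_lift_is_linear (tens_shuffle_bilin1 q) k.
move=> q q'; elim/tens_ind: p => [u v|x y /= hx hy].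
  rewrite /= !tens_lift_pure; try exact: tens_shuffle_bilin1.
  by rewrite /inner linearP.
have lin z x' y' := tens_lift_is_linear (tens_shuffle_bilin1 z) 1 x' y'.
move: (lin (k *: q + q') x y) (lin q x y) (lin q' x y); rewrite !scale1r /= => -> -> ->.
by rewrite hx hy scalerDr addrACA.
Qed.
HB.instance Definition _ :=
  GRing.isLinear.Build K ((U ⊙ V) ⊙ (W ⊙ X)) ((U ⊙ W) ⊙ (V ⊙ X)) *:%R
  (@tens_shuffle U V W X) (tens_lift_is_linear tens_shuffle_bilin).
Lemma tens_shuffleE u v w x :
  @tens_shuffle U V W X ((u ⊗ v) ⊗ (w ⊗ x)) = (u ⊗ w) ⊗ (v ⊗ x).
Proof.
rewrite /tens_shuffle tens_lift_pure; last exact: tens_shuffle_bilin.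
by rewrite tens_lift_pure ?tens_mapE //; exact: tens_shuffle_bilin1.
Qed.
End ShuffleTheory.

End TensorMaps.

(* Linear functionals separate points; this gives 1 ⊗ 1 <> 0, which the ring
   structures of the library require. *)
Lemma exists_functional (K : fieldType) (V : lmodType K) (v : V) :
  v != 0 -> exists f : {scalar V}, f v = 1.
Proof.
move=> v0.
pose P (A : set V) := (forall k x y, A x -> A y -> A (k *: x + y)) /\ ~ A v.
have [|A [[Alin Av] Amax]] := @Zorn_bigcup V P.
  move=> F FP tot; split=> [k x y [X FX Xx] [Y FY Yy]|[X FX Xv]].
    have [XY|YX] := tot _ _ FX FY.
      by exists Y => //; apply: (FP _ FY).1 => //; apply: XY.
    by exists X => //; apply: (FP _ FX).1 => //; apply: YX.
  by have [] := FP _ FX.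
have A0 : A 0.
  have [[x Ax]|nA] := pselect (exists x, A x).
    by have := Alin (-1) x x Ax Ax; rewrite scaleN1r addNr.
  exfalso; apply: (Amax [set 0]%classic _ _).
    by split=> [x Ax|/(_ 0 erefl) Ax]; case: nA; [exists x|exists 0].
  split=> [k x y -> ->|/esym/eqP]; first by rewrite /= scaler0 addr0.
  by rewrite eq_sym (negPf v0).
have AD x y : A x -> A y -> A (x + y).
  by move=> Ax Ay; rewrite -[x]scale1r; apply: Alin.
have AZ k x : A x -> A (k *: x).
  by move=> Ax; rewrite -[X in A X]addr0; apply: Alin.
have ex x : exists k, A (x - k *: v).
  have [Ax|nAx] := pselect (A x); first by exists 0; rewrite scale0r subr0.
  apply: contrapT => nk.
  apply: (Amax [set y | exists k a, A a /\ y = a + k *: x]%classic _ _).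
    split=> [y Ay|sub]; first by exists 0, y; rewrite scale0r addr0.
    apply: nAx; apply: sub; exists 1, 0.
    by rewrite scale1r add0r.
  split=> [k _ _ [k1 [a1 [Aa1 ->]]] [k2 [a2 [Aa2 ->]]]|[k [a [Aa vE]]]].
    exists (k * k1 + k2), (k *: a1 + a2); split; first exact: Alin.
    by rewrite scalerDr scalerDl scalerA addrACA.
  have k0 : k != 0.
    by apply/eqP => k0; apply: Av; rewrite vE k0 scale0r addr0.
  apply: nk; exists k^-1; rewrite vE scalerDr scalerA mulVf // scale1r.
  by rewrite opprD addrCA subrr addr0 -scalerN; apply: (AZ); rewrite -scaleN1r; apply: AZ.
have uniq k : A (k *: v) -> k = 0.
  move=> Akv; apply/eqP; apply/negPn/negP => k0; apply: Av.
  by rewrite -[v]scale1r -(mulVf k0) -scalerA; apply: AZ.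
pose f x := projT1 (cid (ex x)).
have fP x : A (x - f x *: v) by rewrite /f; case: cid.
have fE x k : A (x - k *: v) -> f x = k.
  move=> Ak; apply/eqP; rewrite -subr_eq0; apply/eqP; apply: (uniq).
  have -> : (f x - k) *: v = -1 *: (x - f x *: v) + (x - k *: v).
    by rewrite scaleN1r opprB addrA subrK scalerBl.
  by apply: AD => //; apply: AZ.
have flin : linear_for *%R f.
  move=> k x y; apply: fE.
  have -> : k *: x + y - (k * f x + f y) *: v
          = k *: (x - f x *: v) + (y - f y *: v).
    by rewrite scalerDl scalerBr opprD scalerA addrACA.
  by apply: AD => //; apply: AZ.
pose m := GRing.isLinear.Build K V K *%R f flin.
pose F : {scalar V} := HB.pack f m.
by exists F; apply: fE; rewrite scale1r subrr.
Qed.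

Definition left_mul (K : fieldType) (A : algType K) (a x : A) : A := a * x.
Fact left_mul_linear (K : fieldType) (A : algType K) (a : A) : linear (left_mul a).
Proof. by move=> k x y; rewrite /left_mul mulrDr scalerAr. Qed.
HB.instance Definition _ (K : fieldType) (A : algType K) (a : A) :=
  GRing.isLinear.Build K A A *:%R (left_mul a) (left_mul_linear a).

Section TensorAlgebra.
Variables (K : fieldType) (A B : algType K).

Let mul_inner (y : A ⊙ B) (a : A) (b : B) : A ⊙ B :=
  tens_map (left_mul a) (left_mul b) y.

Definition tens_mul (x y : A ⊙ B) : A ⊙ B :=
  tens_lift (fun a b => tens_map (left_mul a) (left_mul b) y) x.

Definition tens_one : A ⊙ B := 1 ⊗ 1.

Fact tens_mul_bilin1 y : bilinear_for *:%R *:%R (mul_inner y).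
Proof.
rewrite /mul_inner; split=> [b|a] k u v /=; elim/tens_ind: y => [a' b'|p q hp hq].
- by rewrite !tens_mapE /= /left_mul mulrDl -scalerAl pure_tensDl pure_tensZl.
- by rewrite !raddfD /= hp hq addrACA.
- by rewrite !tens_mapE /= /left_mul mulrDl -scalerAl pure_tensDr pure_tensZr.
- by rewrite !raddfD /= hp hq addrACA.
Qed.

Lemma tens_mulE a b a' b' : tens_mul (a ⊗ b) (a' ⊗ b') = (a * a') ⊗ (b * b').
Proof.
rewrite /tens_mul tens_lift_pure ?tens_mapE //; exact: (tens_mul_bilin1 (a' ⊗ b')).
Qed.

Fact tens_mul_linl y : linear (tens_mul^~ y).
Proof. exact: (tens_lift_is_linear (tens_mul_bilin1 y)). Qed.

Fact tens_mulDl : left_distributive tens_mul +%R.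
Proof. by move=> x y z; have := tens_mul_linl z 1 x y; rewrite !scale1r. Qed.

Fact tens_mul_linr x : linear (tens_mul x).
Proof.
move=> k y z; elim/tens_ind: x => [a b|p q hp hq].
  have E t : tens_mul (a ⊗ b) t = tens_map (left_mul a) (left_mul b) t.
    exact: tens_lift_pure (tens_mul_bilin1 t).
  by rewrite !E linearP.
by rewrite !tens_mulDl hp hq scalerDr addrACA.
Qed.

Fact tens_mulDr : right_distributive tens_mul +%R.
Proof. by move=> x y z; have := tens_mul_linr x 1 y z; rewrite !scale1r. Qed.

Fact tens_mulA : associative tens_mul.
Proof.
move=> x y z; elim/tens_ind: x => [a b|p q hp hq]; last by rewrite !tens_mulDl hp hq.
elim/tens_ind: y => [a' b'|p q hp hq]; last by rewrite !(tens_mulDl, tens_mulDr) hp hq.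
elim/tens_ind: z => [a2 b2|p q hp hq]; last by rewrite !tens_mulDr hp hq.
by rewrite !tens_mulE !mulrA.
Qed.

Fact tens_mul1l : left_id tens_one tens_mul.
Proof.
by elim/tens_ind => [a b|p q hp hq]; rewrite ?tens_mulE ?mul1r ?tens_mulDr ?hp ?hq.
Qed.
Fact tens_mul1r : right_id tens_one tens_mul.
Proof.
by elim/tens_ind => [a b|p q hp hq]; rewrite ?tens_mulE ?mulr1 ?tens_mulDl ?hp ?hq.
Qed.

Fact tens_one_neq0 : tens_one != 0.
Proof.
have [f f1] := exists_functional (oner_neq0 A).
have [g g1] := exists_functional (oner_neq0 B).
have fg : bilinear_for *:%R *:%R (fun a b => f a * g b : K^o).
  split=> [b|a] k u v /=; rewrite linearP; first by rewrite mulrDl -mulrA.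
  by rewrite mulrDr mulrCA.
apply/eqP => /(congr1 (tens_lift (fun a b => f a * g b : K^o))).
have lin := tens_lift_is_linear fg.
have -> : tens_lift (fun a b => f a * g b : K^o) 0 = 0.
  by have := lin (-1) 0 0; rewrite !scaleN1r addNr => ->; rewrite addNr.
by rewrite tens_lift_pure // f1 g1 mulr1 => /eqP; rewrite oner_eq0.
Qed.

HB.instance Definition _ := GRing.Zmodule_isNzRing.Build (A ⊙ B)
  tens_mulA tens_mul1l tens_mul1r tens_mulDl tens_mulDr tens_one_neq0.

Fact tens_scaleAl k (x y : A ⊙ B) : k *: (x * y) = (k *: x) * y.
Proof.
have := tens_mul_linl y k x 0; rewrite addr0 -[tens_mul 0 y]/(0 * y) mul0r addr0.
by [].

Qed.
HB.instance Definition _ := GRing.Lmodule_isLalgebra.Build K (A ⊙ B) tens_scaleAl.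

Fact tens_scaleAr k (x y : A ⊙ B) : k *: (x * y) = x * (k *: y).
Proof.
have := tens_mul_linr x k y 0; rewrite addr0 -[tens_mul x 0]/(x * 0) mulr0 addr0.
by [].

Qed.
HB.instance Definition _ := GRing.Lalgebra_isAlgebra.Build K (A ⊙ B) tens_scaleAr.

Lemma pure_tensM (a a' : A) (b b' : B) : (a ⊗ b) * (a' ⊗ b') = (a * a') ⊗ (b * b').
Proof. exact: tens_mulE. Qed.
Lemma tens1E : 1 = 1 ⊗ 1 :> A ⊙ B. Proof. by []. Qed.

End TensorAlgebra.

HB.mixin Record isStarAlgebra (C : numClosedFieldType) A of GRing.Algebra C A := {
  star : A -> A;
  star_antilinear : forall (k : C) x y, star (k *: x + y) = k^* *: star x + star y;
  starM : forall x y, star (x * y) = star y * star x;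
  starK : involutive star
}.
#[short(type="starAlgType")]
HB.structure Definition StarAlgebra (C : numClosedFieldType) :=
  {A of isStarAlgebra C A & GRing.Algebra C A}.

Section StarTheory.
Variables (C : numClosedFieldType) (A : starAlgType C).
Implicit Types x y : A.

Lemma starD x y : star (x + y) = star x + star y.
Proof. by rewrite -[x]scale1r star_antilinear rmorph1 !scale1r. Qed.
Lemma star0 : star (0 : A) = 0.
Proof. by apply: (addrI (star 0)); rewrite -starD !addr0. Qed.
Lemma starZ k x : star (k *: x) = k^* *: star x.
Proof. by rewrite -[k *: x]addr0 star_antilinear star0 addr0. Qed.
Lemma star1 : star (1 : A) = 1.
Proof. by rewrite -[star 1]mulr1 -{2}[1]starK -starM mulr1 starK. Qed.

Definition is_state (phi : {scalar A}) : Prop :=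
  phi 1 = 1 /\ forall x, 0 <= phi (star x * x).
End StarTheory.

(* The conjugate vector space, which turns antilinear maps into linear ones. *)
Section ConjugateModule.
Variables (C : numClosedFieldType) (V : lmodType C).
Definition conj_mod : Type := V.
HB.instance Definition _ := GRing.Zmodule.on conj_mod.
Definition conj_scale (k : C) (v : conj_mod) : conj_mod := k^* *: (v : V).
Fact conj_scaleA a b v : conj_scale a (conj_scale b v) = conj_scale (a * b) v.
Proof. by rewrite /conj_scale scalerA rmorphM. Qed.
Fact conj_scale1 : left_id 1 conj_scale.
Proof. by move=> v; rewrite /conj_scale rmorph1 scale1r. Qed.
Fact conj_scaleDr : right_distributive conj_scale +%R.
Proof. by move=> a u v; rewrite /conj_scale scalerDr. Qed.
Fact conj_scaleDl v : {morph conj_scale^~ v : a b / a + b}.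
Proof. by move=> a b; rewrite /conj_scale rmorphD scalerDl. Qed.
HB.instance Definition _ := GRing.Zmodule_isLmodule.Build C conj_mod
  conj_scaleA conj_scale1 conj_scaleDr conj_scaleDl.
End ConjugateModule.

Section TensorStar.
Variables (C : numClosedFieldType) (A B : starAlgType C).

Definition tens_star : A ⊙ B -> A ⊙ B :=
  tens_lift (fun a b => star a ⊗ star b : conj_mod (A ⊙ B)).

Fact tens_star_bilin : bilinear_for *:%R *:%R
  (fun (a : A) (b : B) => star a ⊗ star b : conj_mod (A ⊙ B)).
Proof.
split=> [b|a] k x y /=; rewrite star_antilinear.
  by rewrite pure_tensDl pure_tensZl.
by rewrite pure_tensDr pure_tensZr.
Qed.
Lemma tens_starE a b : tens_star (a ⊗ b) = star a ⊗ star b.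
Proof. exact: tens_lift_pure tens_star_bilin. Qed.
Fact tens_star_antilinear k x y :
  tens_star (k *: x + y) = k^* *: tens_star x + tens_star y.
Proof. exact: (tens_lift_is_linear tens_star_bilin k x y). Qed.
Let tens_starD x y : tens_star (x + y) = tens_star x + tens_star y.
Proof. by rewrite -[x]scale1r tens_star_antilinear rmorph1 !scale1r. Qed.
Fact tens_starM x y : tens_star (x * y) = tens_star y * tens_star x.
Proof.
elim/tens_ind: x => [a b|p q hp hq]; last by rewrite mulrDl !tens_starD mulrDr hp hq.
elim/tens_ind: y => [a' b'|p q hp hq]; last by rewrite mulrDr !tens_starD mulrDl hp hq.
by rewrite !(pure_tensM, tens_starE) !starM.
Qed.
Fact tens_starK : involutive tens_star.
Proof.
by elim/tens_ind => [a b|p q hp hq]; rewrite ?tens_starE ?starK // !tens_starD hp hq.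
Qed.
HB.instance Definition _ := isStarAlgebra.Build C (A ⊙ B)
  tens_star_antilinear tens_starM tens_starK.

Lemma star_pure_tens (a : A) (b : B) : star (a ⊗ b) = star a ⊗ star b.
Proof. exact: tens_starE. Qed.
End TensorStar.

Section Slices.
Variable C : numClosedFieldType.

(* f ⊗ id, id ⊗ f and f ⊗ g, under C ⊗ W = W, V ⊗ C = V and C ⊗ C = C *)
Definition slice_l (V W : lmodType C) (f : V -> C) : V ⊙ W -> W :=
  tens_lift (fun v w => f v *: w).
Definition slice_r (V W : lmodType C) (f : W -> C) : V ⊙ W -> V :=
  tens_lift (fun v w => f w *: v).
Definition tens_form (V W : lmodType C) (f : V -> C) (g : W -> C) : V ⊙ W -> C :=
  tens_lift (fun v w => f v * g w : C^o).

End Slices.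

(* That counit intertwines star with complex conjugation follows from
   comul_star and uniqueness of the counit. *)
HB.mixin Record isStarBialgebra (C : numClosedFieldType) A of StarAlgebra C A := {
  comul : {lrmorphism A -> A ⊙ A};
  counit : {lrmorphism A -> C | *%R};
  comul_star : forall a : A, comul (star a) = star (comul a);
  comulA : forall a : A,
    tens_assoc (tens_map comul idfun (comul a)) = tens_map idfun comul (comul a);
  counitl : forall a : A, slice_l counit (comul a) = a;
  counitr : forall a : A, slice_r counit (comul a) = a
}.
#[short(type="starBialgType")]
HB.structure Definition StarBialgebra (C : numClosedFieldType) :=
  {A of isStarBialgebra C A & StarAlgebra C A}.

HB.mixin Record isHopfStarAlgebra (C : numClosedFieldType) A of StarBialgebra C A := {
  antipode : {linear A -> A};
  antipodel : forall a : A,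
    tens_lift (fun x y => antipode x * y) (comul a) = (counit a)%:A;
  antipoder : forall a : A,
    tens_lift (fun x y => x * antipode y) (comul a) = (counit a)%:A
}.
#[short(type="hopfStarAlgType")]
HB.structure Definition HopfStarAlgebra (C : numClosedFieldType) :=
  {A of isHopfStarAlgebra C A & StarBialgebra C A}.

Definition unitary_corep (C : numClosedFieldType) (A : starBialgType C)
    n (u : 'M[A]_n) : Prop :=
  [/\ forall i j, comul (u i j) = \sum_k u i k ⊗ u k j,
      forall i j, \sum_k u i k * star (u j k) = (i == j)%:R &
      forall i j, \sum_k star (u k i) * u k j = (i == j)%:R].

(* A compact quantum group is represented by its Hopf *-algebra Pol(G): the
   elements are the coefficients of the finite-dimensional unitary
   corepresentations (a direct sum of corepresentations makes a single u
   suffice), and haar is the bi-invariant state, which is then unique and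
   faithful. *)
HB.mixin Record isCQG (C : numClosedFieldType) A of HopfStarAlgebra C A := {
  unitary_coeff : forall a : A, exists n (u : 'M[A]_n) (c : 'M[C]_n),
    unitary_corep u /\ a = \sum_i \sum_j c i j *: u i j;
  haar : {scalar A};
  haar_state : is_state haar;
  haar_invl : forall a : A, slice_l haar (comul a) = (haar a)%:A;
  haar_invr : forall a : A, slice_r haar (comul a) = (haar a)%:A
}.
#[short(type="cqgType")]
HB.structure Definition CQG (C : numClosedFieldType) :=
  {A of isCQG C A & HopfStarAlgebra C A}.

Definition kac_type (C : numClosedFieldType) (A : cqgType C) : Prop :=
  forall a b : A, haar (a * b) = haar (b * a).

Definition idempotent_functional (C : numClosedFieldType) (A : starBialgType C)
    (phi : {scalar A}) : Prop :=
  forall x : A, tens_form phi phi (comul x) = phi x.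

Definition idempotent_state (C : numClosedFieldType) (A : starBialgType C)
    (phi : {scalar A}) : Prop :=
  is_state phi /\ idempotent_functional phi.

Section TensorMultiplicative.
Variables (K : fieldType) (A B D : algType K) (f : {linear A ⊙ B -> D}).
Hypothesis fM : forall a a' b b',
  f ((a * a') ⊗ (b * b')) = f (a ⊗ b) * f (a' ⊗ b').
Lemma tens_multiplicative x y : f (x * y) = f x * f y.
Proof.
elim/tens_ind: x => [a b|p q hp hq]; last by rewrite !(mulrDl, linearD) /= hp hq.
elim/tens_ind: y => [a' b'|p q hp hq]; last by rewrite !(mulrDr, linearD) /= hp hq.
by rewrite pure_tensM fM.
Qed.
End TensorMultiplicative.

Section TensorStarMorphism.
Variables (C : numClosedFieldType) (A B D : starAlgType C) (f : {linear A ⊙ B -> D}).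
Hypothesis fS : forall a b, f (star a ⊗ star b) = star (f (a ⊗ b)).
Lemma tens_star_morph x : f (star x) = star (f x).
Proof.
elim/tens_ind: x => [a b|p q hp hq]; first by rewrite star_pure_tens fS.
by rewrite !(starD, linearD) /= hp hq.
Qed.
End TensorStarMorphism.

Section TensorMapMorphism.
Variables (K : fieldType) (A B A' B' : algType K).
Variables (f : {lrmorphism A -> A'}) (g : {lrmorphism B -> B'}).
Lemma tens_mapM (x y : A ⊙ B) : tens_map f g (x * y) = tens_map f g x * tens_map f g y.
Proof.
by apply: tens_multiplicative => a a' b b'; rewrite /= !tens_mapE /= !rmorphM pure_tensM.
Qed.
Lemma tens_map1 : tens_map f g (1 : A ⊙ B) = 1.
Proof. by rewrite tens1E tens_mapE /= !rmorph1. Qed.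
Lemma tens_swapM (x y : A ⊙ B) : tens_swap (x * y) = tens_swap x * tens_swap y.
Proof.
by apply: tens_multiplicative => a a' b b'; rewrite /= !tens_swapE /= pure_tensM.
Qed.
Lemma tens_swap1 : tens_swap (1 : A ⊙ B) = 1.
Proof. by rewrite tens1E tens_swapE. Qed.
End TensorMapMorphism.

Section ShuffleMorphism.
Variables (K : fieldType) (A B A' B' : algType K).
Lemma tens_shuffleM (x y : (A ⊙ B) ⊙ (A' ⊙ B')) :
  tens_shuffle (x * y) = tens_shuffle x * tens_shuffle y.
Proof.
apply: tens_multiplicative => p p' q q'.
elim/tens_ind: p => [a b|u v hu hv]; last by rewrite !(mulrDl, mulrDr, pure_tensDl, pure_tensDr, linearD) /=  hu hv.
elim/tens_ind: p' => [a2 b2|u v hu hv]; last by rewrite !(mulrDl, mulrDr, pure_tensDl, pure_tensDr, linearD) /=  hu hv.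
elim/tens_ind: q => [c d|u v hu hv]; last by rewrite !(mulrDl, mulrDr, pure_tensDl, pure_tensDr, linearD) /=  hu hv.
elim/tens_ind: q' => [c2 d2|u v hu hv]; last by rewrite !(mulrDl, mulrDr, pure_tensDl, pure_tensDr, linearD) /=  hu hv.
rewrite /= !pure_tensM.
by rewrite !tens_shuffleE !pure_tensM.
Qed.
Lemma tens_shuffle1 : tens_shuffle (1 : (A ⊙ B) ⊙ (A' ⊙ B')) = 1.
Proof. by rewrite tens1E !tens1E tens_shuffleE. Qed.
End ShuffleMorphism.

Section SliceTheory.
Variables (C : numClosedFieldType) (V W : lmodType C).

Section L.
Variable f : {scalar V}.
Fact slice_l_bilin : bilinear_for *:%R *:%R (fun v (w : W) => f v *: w).
Proof.
split=> [w|v] k x y /=; first by rewrite linearP scalerDl scalerA.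
by rewrite scalerDr !scalerA mulrC.
Qed.
HB.instance Definition _ := GRing.isLinear.Build C (V ⊙ W) W *:%R
  (@slice_l C V W f) (tens_lift_is_linear slice_l_bilin).
Lemma slice_lE v (w : W) : slice_l f (v ⊗ w) = f v *: w.
Proof. exact: tens_lift_pure slice_l_bilin. Qed.
End L.

Section R.
Variable f : {scalar W}.
Fact slice_r_bilin : bilinear_for *:%R *:%R (fun (v : V) w => f w *: v).
Proof.
split=> [w|v] k x y /=; last by rewrite linearP scalerDl scalerA.
by rewrite scalerDr !scalerA mulrC.
Qed.
HB.instance Definition _ := GRing.isLinear.Build C (V ⊙ W) V *:%R
  (@slice_r C V W f) (tens_lift_is_linear slice_r_bilin).
Lemma slice_rE (v : V) w : slice_r f (v ⊗ w) = f w *: v.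
Proof. exact: tens_lift_pure slice_r_bilin. Qed.
End R.

Section Form.
Variables (f : {scalar V}) (g : {scalar W}).
Fact tens_form_bilin : bilinear_for *:%R *:%R (fun v w => f v * g w : C^o).
Proof.
split=> [w|v] k x y /=; rewrite linearP; first by rewrite mulrDl -mulrA.
by rewrite mulrDr mulrCA.
Qed.
HB.instance Definition _ := GRing.isLinear.Build C (V ⊙ W) C *%R
  (tens_form f g) (tens_lift_is_linear tens_form_bilin).
Lemma tens_formE v w : tens_form f g (v ⊗ w) = f v * g w.
Proof. exact: tens_lift_pure tens_form_bilin. Qed.
End Form.
End SliceTheory.

(* The co-opposite *-bialgebra; tilde is the formal identity map. *)
Section Cop.
Variable (C : numClosedFieldType).

Definition cop (A : Type) : Type := A.
HB.instance Definition _ (A : starAlgType C) := StarAlgebra.on (cop A).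

Definition tilde (A : starAlgType C) (a : A) : cop A := a.
Definition untilde (A : starAlgType C) (a : cop A) : A := a.

HB.instance Definition _ (A : starAlgType C) := GRing.LRMorphism.copy (@tilde A) (@idfun A).

Section Bialgebra.
Variable A : starBialgType C.

Definition cop_flip : A ⊙ A -> cop A ⊙ cop A :=
  tens_map (@tilde A) (@tilde A) \o @tens_swap C A A.
HB.instance Definition _ := GRing.Linear.copy cop_flip
  (tens_map (@tilde A) (@tilde A) \o @tens_swap C A A).

Lemma cop_flipE (a b : A) : cop_flip (a ⊗ b) = tilde b ⊗ tilde a.
Proof. by rewrite /cop_flip /= tens_swapE tens_mapE. Qed.

Definition comul_cop (a : cop A) : cop A ⊙ cop A := cop_flip (comul (untilde a)).

Fact comul_cop_linear : linear comul_cop.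
Proof. by move=> k x y; rewrite /comul_cop -!linearP. Qed.
Fact comul_cop_monoid : monoid_morphism comul_cop.
Proof.
split=> [|x y]; rewrite /comul_cop /cop_flip /=.
  by rewrite [comul _]rmorph1 tens_swap1 tens_map1.
by rewrite [comul _]rmorphM tens_swapM tens_mapM.
Qed.
HB.instance Definition _ := GRing.isLinear.Build C (cop A) (cop A ⊙ cop A) *:%R
  comul_cop comul_cop_linear.
HB.instance Definition _ := GRing.isMonoidMorphism.Build (cop A) (cop A ⊙ cop A)
  comul_cop comul_cop_monoid.

Definition counit_cop (a : cop A) : C := counit (untilde a).
HB.instance Definition _ := GRing.LRMorphism.copy counit_cop (@counit C A).

Fact comul_cop_star (a : cop A) : comul_cop (star a) = star (comul_cop a).
Proof.
rewrite /comul_cop [comul _]comul_star; apply: tens_star_morph => x y.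
by rewrite /= !cop_flipE star_pure_tens.
Qed.

Let rev3 (z : A ⊙ (A ⊙ A)) : cop A ⊙ (cop A ⊙ cop A) :=
  tens_assoc (tens_swap (tens_map (@tilde A) cop_flip z)).

Let rev3D x y : rev3 (x + y) = rev3 x + rev3 y.
Proof. by rewrite /rev3 !raddfD. Qed.

Let rev3E (a : A) (y : A ⊙ A) : rev3 (a ⊗ y) = tens_assoc (cop_flip y ⊗ tilde a).
Proof. by rewrite /rev3 tens_mapE tens_swapE. Qed.

Fact comul_copA (a : cop A) :
  tens_assoc (tens_map comul_cop idfun (comul_cop a)) =
  tens_map idfun comul_cop (comul_cop a).
Proof.
have L (t : A ⊙ A) : tens_assoc (tens_map comul_cop idfun (cop_flip t))
    = rev3 (tens_map idfun comul t).
  elim/tens_ind: t => [x y|p q hp hq]; last by rewrite !raddfD /= rev3D hp hq.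
  by rewrite cop_flipE !tens_mapE rev3E.
have R (t : A ⊙ A) : tens_map idfun comul_cop (cop_flip t)
    = rev3 (tens_assoc (tens_map comul idfun t)).
  elim/tens_ind: t => [x y|p q hp hq]; last by rewrite !raddfD /= rev3D hp hq.
  rewrite cop_flipE !tens_mapE /= /comul_cop /=.
  have -> : untilde (tilde x) = x by [].
  elim/tens_ind: (comul x) => [u v|p q hp hq].
    by rewrite cop_flipE tens_assocE rev3E cop_flipE tens_assocE.
  by rewrite raddfD pure_tensDr hp hq pure_tensDl raddfD rev3D.
by rewrite /comul_cop L R comulA.
Qed.

Fact counit_copl (a : cop A) : slice_l counit_cop (comul_cop a) = a.
Proof.
rewrite -[RHS](@counitr C A (untilde a)) /comul_cop.
elim/tens_ind: (comul (untilde a)) => [x y|p q hp hq].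
  by rewrite cop_flipE slice_lE slice_rE.
by rewrite !raddfD /= hp hq.
Qed.
Fact counit_copr (a : cop A) : slice_r counit_cop (comul_cop a) = a.
Proof.
rewrite -[RHS](@counitl C A (untilde a)) /comul_cop.
elim/tens_ind: (comul (untilde a)) => [x y|p q hp hq].
  by rewrite cop_flipE slice_lE slice_rE.
by rewrite !raddfD /= hp hq.
Qed.

HB.instance Definition _ := isStarBialgebra.Build C (cop A)
  comul_cop_star comul_copA counit_copl counit_copr.

End Bialgebra.
End Cop.

(* The tensor product *-bialgebra, with coproduct
   a ⊗ b |-> (a_(1) ⊗ b_(1)) ⊗ (a_(2) ⊗ b_(2)). *)
Section TensorBialgebra.
Variables (C : numClosedFieldType) (A B : starBialgType C).

Definition tens_comul : A ⊙ B -> (A ⊙ B) ⊙ (A ⊙ B) :=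
  @tens_shuffle C A A B B \o tens_map (@comul C A) (@comul C B).
HB.instance Definition _ := GRing.Linear.copy tens_comul
  (@tens_shuffle C A A B B \o tens_map (@comul C A) (@comul C B)).

Lemma tens_comulE a b : tens_comul (a ⊗ b) = tens_shuffle (comul a ⊗ comul b).
Proof. by rewrite /tens_comul /= tens_mapE. Qed.

Fact tens_comul_monoid : monoid_morphism tens_comul.
Proof.
split=> [|x y]; rewrite /tens_comul /=.
  by rewrite tens_map1 tens_shuffle1.
by rewrite tens_mapM tens_shuffleM.
Qed.
HB.instance Definition _ := GRing.isMonoidMorphism.Build (A ⊙ B)
  ((A ⊙ B) ⊙ (A ⊙ B)) tens_comul tens_comul_monoid.

Definition tens_counit : A ⊙ B -> C := tens_form (@counit C A) (@counit C B).
HB.instance Definition _ := GRing.Linear.copy tens_counit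
  (tens_form (@counit C A) (@counit C B)).
Lemma tens_counitE a b : tens_counit (a ⊗ b) = counit a * counit b.
Proof. exact: tens_formE. Qed.
Fact tens_counit_monoid : monoid_morphism tens_counit.
Proof.
split=> [|x y]; first by rewrite tens1E tens_counitE !rmorph1 mulr1.
elim/tens_ind: x => [a b|p q hp hq]; last by rewrite !(mulrDl, raddfD) /= hp hq.
elim/tens_ind: y => [a' b'|p q hp hq]; last by rewrite !(mulrDr, raddfD) /= hp hq.
by rewrite pure_tensM !tens_counitE !rmorphM mulrACA.
Qed.
HB.instance Definition _ := GRing.isMonoidMorphism.Build (A ⊙ B) C
  tens_counit tens_counit_monoid.

Fact tens_comul_star x : tens_comul (star x) = star (tens_comul x).
Proof.
apply: tens_star_morph => a b; rewrite /= !tens_comulE !comul_star.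
rewrite -star_pure_tens; move: (comul a ⊗ comul b) => t.
apply: tens_star_morph => p q.
elim/tens_ind: p => [u v|p p' hp hp'].
  elim/tens_ind: q => [u' v'|q q' hq hq'].
    by rewrite /= !star_pure_tens !tens_shuffleE /= !star_pure_tens.
  by rewrite !(starD, pure_tensDr, linearD) /= hq hq'.
by rewrite !(starD, pure_tensDl, linearD) /= hp hp'.
Qed.

Let shuffle3 (z : (A ⊙ (A ⊙ A)) ⊙ (B ⊙ (B ⊙ B))) : (A ⊙ B) ⊙ ((A ⊙ B) ⊙ (A ⊙ B)) :=
  tens_map idfun (@tens_shuffle C A A B B) (tens_shuffle z).
Let shuffle3D x y : shuffle3 (x + y) = shuffle3 x + shuffle3 y.
Proof. by rewrite /shuffle3 !raddfD. Qed.

Fact tens_comulA x :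
  tens_assoc (tens_map tens_comul idfun (tens_comul x)) =
  tens_map idfun tens_comul (tens_comul x).
Proof.
have S1 P Q (a : A) (b : B) : tens_assoc (tens_shuffle (P ⊗ Q) ⊗ (a ⊗ b))
    = shuffle3 (tens_assoc (P ⊗ a) ⊗ tens_assoc (Q ⊗ b)).
  elim/tens_ind: P => [u v|p p' hp hp'].
    elim/tens_ind: Q => [u' v'|q q' hq hq'].
      by rewrite /shuffle3 !(tens_shuffleE, tens_assocE, tens_mapE) /= !tens_shuffleE.
    by rewrite !(pure_tensDl, pure_tensDr, linearD) /= shuffle3D hq hq'.
  by rewrite !(pure_tensDl, pure_tensDr, linearD) /= shuffle3D hp hp'.
have L p q : tens_assoc (tens_map tens_comul idfun (tens_shuffle (p ⊗ q)))
    = shuffle3 (tens_assoc (tens_map comul idfun p) ⊗ tens_assoc (tens_map comul idfun q)).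
  elim/tens_ind: p => [u v|p p' hp hp'].
    elim/tens_ind: q => [u' v'|q q' hq hq'].
      by rewrite tens_shuffleE !tens_mapE /= tens_comulE S1.
    by rewrite !(pure_tensDl, pure_tensDr, linearD) /= shuffle3D hq hq'.
  by rewrite !(pure_tensDl, pure_tensDr, linearD) /= shuffle3D hp hp'.
have R p q : tens_map idfun tens_comul (tens_shuffle (p ⊗ q))
    = shuffle3 (tens_map idfun comul p ⊗ tens_map idfun comul q).
  elim/tens_ind: p => [u v|p p' hp hp'].
    elim/tens_ind: q => [u' v'|q q' hq hq'].
      by rewrite /shuffle3 tens_shuffleE !tens_mapE /= tens_comulE tens_shuffleE tens_mapE.
    by rewrite !(pure_tensDl, pure_tensDr, linearD) /= shuffle3D hq hq'.
  by rewrite !(pure_tensDl, pure_tensDr, linearD) /= shuffle3D hp hp'.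
elim/tens_ind: x => [a b|p q hp hq]; last by rewrite !linearD /= hp hq.
by rewrite tens_comulE L R !comulA.
Qed.

Fact tens_counitl x : slice_l tens_counit (tens_comul x) = x.
Proof.
have L p q : slice_l tens_counit (tens_shuffle (p ⊗ q))
    = slice_l (@counit C A) p ⊗ slice_l (@counit C B) q.
  elim/tens_ind: p => [u v|p p' hp hp'].
    elim/tens_ind: q => [u' v'|q q' hq hq'].
      rewrite tens_shuffleE !slice_lE /= tens_counitE.
      by rewrite pure_tensZl pure_tensZr scalerA.
    by rewrite !(pure_tensDr, linearD) /= hq hq'.
  by rewrite !(pure_tensDl, linearD) /= hp hp'.
elim/tens_ind: x => [a b|p q hp hq]; last by rewrite !linearD /= hp hq.
by rewrite tens_comulE L !counitl.
Qed.
Fact tens_counitr x : slice_r tens_counit (tens_comul x) = x.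
Proof.
have L p q : slice_r tens_counit (tens_shuffle (p ⊗ q))
    = slice_r (@counit C A) p ⊗ slice_r (@counit C B) q.
  elim/tens_ind: p => [u v|p p' hp hp'].
    elim/tens_ind: q => [u' v'|q q' hq hq'].
      rewrite tens_shuffleE !slice_rE /= tens_counitE.
      by rewrite pure_tensZl pure_tensZr scalerA.
    by rewrite !(pure_tensDr, linearD) /= hq hq'.
  by rewrite !(pure_tensDl, linearD) /= hp hp'.
elim/tens_ind: x => [a b|p q hp hq]; last by rewrite !linearD /= hp hq.
by rewrite tens_comulE L !counitr.
Qed.

HB.instance Definition _ := isStarBialgebra.Build C (A ⊙ B)
  tens_comul_star tens_comulA tens_counitl tens_counitr.

Lemma comul_pure_tens (a : A) (b : B) : comul (a ⊗ b) = tens_shuffle (comul a ⊗ comul b).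
Proof. exact: tens_comulE. Qed.
End TensorBialgebra.

(* The Sweedler formula for the coproduct of A ⊙ cop A. *)
Lemma comul_tens_cop (C : numClosedFieldType) (A : starBialgType C) (a b : A)
    (s t : seq (A * A)) :
  comul a = \sum_(p <- s) p.1 ⊗ p.2 -> comul b = \sum_(q <- t) q.1 ⊗ q.2 ->
  comul (a ⊗ tilde b) =
    \sum_(p <- s) \sum_(q <- t) (p.1 ⊗ tilde q.2) ⊗ (p.2 ⊗ tilde q.1).
Proof.
move=> Ea Eb; rewrite comul_pure_tens -[comul (tilde b)]/(cop_flip (comul b)) Ea Eb.
elim: s {Ea} => [|p s IH].
  by rewrite !big_nil -(scale0r 0) pure_tensZl !scale0r raddf0.
rewrite !big_cons pure_tensDl raddfD /= IH; congr (_ + _).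
elim: t {Eb IH} => [|q t IH].
  by rewrite !big_nil raddf0 -[X in _ ⊗ X](scale0r 0) pure_tensZr !scale0r raddf0.
by rewrite !big_cons raddfD pure_tensDr raddfD /= IH cop_flipE tens_shuffleE.
Qed.

(* Main.v *)
(* [Pol(G)] is spanned by coefficients of unitary corepresentations u, on which
   [S(u_ij) = u_ji^*]; applied to products of corepresentations, this makes S
   antimultiplicative.  If h is a trace, invariance of h forces the conjugate of
   u to be unitary as well, so that S commutes with the involution.  Hence
   [phi_D(x^* y) = h(m(x)^* m(y))] with [m(a ⊗ b) = a S(b)], which gives
   positivity.  Idempotence is the invariance of h on the corepresentation
   u ⊗ v^bar, as [phi_D(u_ij ⊗ v_kl) = h(u_ij S(v_kl))]
   and [S(v_kl) = v_lk^*]. *)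
Require Import Defs.
From HB Require Import structures.
From mathcomp Require Import all_boot all_order all_algebra.
From mathcomp Require Import reals complex.

Set Implicit Arguments.
Unset Strict Implicit.
Unset Printing Implicit Defensive.

Import Order.TTheory GRing.Theory Num.Theory.
Local Open Scope ring_scope.

(** * Tensors of finite sums *)

Section TensorSums.
Variables (K : nzRingType) (V W : lmodType K).

Lemma pure_tens0l (w : W) : (0 : V) ⊗ w = 0.
Proof. by rewrite -(scale0r 0) pure_tensZl scale0r. Qed.

Lemma pure_tens0r (v : V) : v ⊗ (0 : W) = 0.
Proof. by rewrite -(scale0r 0) pure_tensZr scale0r. Qed.

Lemma pure_tens_suml (I : finType) (F : I -> V) (w : W) :
  (\sum_i F i) ⊗ w = \sum_i F i ⊗ w.
Proof.
by elim/big_rec2: _ => [|i y x _ <-]; rewrite ?pure_tens0l ?pure_tensDl.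
Qed.

Lemma pure_tens_sumr (I : finType) (v : V) (F : I -> W) :
  v ⊗ (\sum_i F i) = \sum_i v ⊗ F i.
Proof. by elim/big_rec2: _ => [|i y x _ <-]; rewrite ?pure_tens0r ?pure_tensDr. Qed.

End TensorSums.

Lemma tens_shuffle_sum (K : comNzRingType) (U V W X : lmodType K) (I J : finType)
    (u : I -> U) (v : I -> V) (w : J -> W) (x : J -> X) :
  tens_shuffle ((\sum_i u i ⊗ v i) ⊗ (\sum_j w j ⊗ x j)) =
    \sum_i \sum_j (u i ⊗ w j) ⊗ (v i ⊗ x j).
Proof.
rewrite pure_tens_suml linear_sum; apply: eq_bigr => i _ /=.
rewrite pure_tens_sumr linear_sum; apply: eq_bigr => j _ /=.
by rewrite tens_shuffleE.
Qed.

(** * Matrix corepresentations, their conjugates and tensor products *)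

Section Corepresentations.
Variables (C : numClosedFieldType) (A : starBialgType C).

(** Indices range over any finite type, so that tensor products of corepresentations are indexed by
    pairs. *)
Definition corep (I : finType) (u : I -> I -> A) : Prop :=
  forall i j, comul (u i j) = \sum_k u i k ⊗ u k j.

Definition right_unitary (I : finType) (u : I -> I -> A) : Prop :=
  forall i j, \sum_k u i k * star (u j k) = (i == j)%:R.

Definition corep_conj (I : finType) (u : I -> I -> A) i j := star (u i j).

Definition corep_prod (I J : finType) (u : I -> I -> A) (v : J -> J -> A)
  (x y : I * J) : A := u x.1 y.1 * v x.2 y.2.

Lemma corep_conjP (I : finType) (u : I -> I -> A) :
  corep u -> corep (corep_conj u).
Proof.
move=> cu i j; rewrite comul_star cu.
rewrite (big_morph _ (@starD _ _) (star0 _)).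
by apply: eq_bigr => k _; rewrite star_pure_tens.
Qed.

Lemma corep_prodP (I J : finType) (u : I -> I -> A) (v : J -> J -> A) :
  corep u -> corep v -> corep (corep_prod u v).
Proof.
move=> cu cv [i i'] [j j']; rewrite /corep_prod [comul _]rmorphM /= cu cv.
rewrite big_distrlr /= pair_bigA /=.
by apply: eq_bigr => -[k k'] _; rewrite pure_tensM.
Qed.

(** In [u v v^* u^*] the inner factor [v v^*] collapses first, then [u u^*]. *)
Lemma right_unitary_prod (I J : finType) (u : I -> I -> A) (v : J -> J -> A) :
  right_unitary u -> right_unitary v -> right_unitary (corep_prod u v).
Proof.
move=> uu uv [i i'] [j j']; rewrite /corep_prod.
rewrite -(pair_bigA _ (fun k k' => u i k * v i' k' * star (u j k * v j' k'))) /=.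
under eq_bigr => k _.
  under eq_bigr => k' _ do rewrite starM mulrA -[X in X * _]mulrA.
  rewrite -mulr_suml -mulr_sumr uv mulr_natr mulrnAl; over.
by rewrite sumrMnl uu -mulrnA mulnb.
Qed.

Lemma slice_l_corep (f : {scalar A}) (I : finType) (u : I -> I -> A) i j :
  corep u -> slice_l f (comul (u i j)) = \sum_k f (u i k) *: u k j.
Proof. by move=> ->; rewrite linear_sum; apply: eq_bigr => k _; rewrite /= slice_lE. Qed.

Lemma slice_r_corep (f : {scalar A}) (I : finType) (u : I -> I -> A) i j :
  corep u -> slice_r f (comul (u i j)) = \sum_k f (u k j) *: u i k.
Proof. by move=> ->; rewrite linear_sum; apply: eq_bigr => k _; rewrite /= slice_rE. Qed.

(** Multiplying the counit law [u i l = \sum_k counit (u i k) *: u k l] by [star (u j l)] and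
    summing over [l] leaves only the term [k = j], by unitarity. *)
Lemma counit_corep (I : finType) (u : I -> I -> A) :
  corep u -> right_unitary u -> forall i j, (counit (u i j))%:A = (i == j)%:R :> A.
Proof.
move=> cu uu i j; rewrite -uu.
under eq_bigr => l _.
  rewrite -[u i l]counitl slice_l_corep // mulr_suml.
  under eq_bigr => k _ do rewrite -scalerAl.
  over.
rewrite exchange_big /= (bigD1 j) //= -scaler_sumr uu eqxx.
rewrite big1 ?addr0 // => k kj.
by rewrite -scaler_sumr uu (negPf kj) scaler0.
Qed.

Lemma comul_corep_cop (I J : finType) (u : I -> I -> A) (v : J -> J -> A) i j k l :
  corep u -> corep v ->
  comul (u i j ⊗ tilde (v k l)) =
    \sum_p \sum_q (u i p ⊗ tilde (v q l)) ⊗ (u p j ⊗ tilde (v k q)).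
Proof.
move=> cu cv.
rewrite comul_pure_tens -[comul (tilde _)]/(cop_flip (comul (v k l))) cu cv.
have -> : cop_flip (\sum_q v k q ⊗ v q l) = \sum_q tilde (v q l) ⊗ tilde (v k q).
  by rewrite linear_sum; apply: eq_bigr => q _; rewrite /= cop_flipE.
exact: tens_shuffle_sum.
Qed.

End Corepresentations.

(** * The antipode on coefficients *)

Section Antipode.
Variables (C : numClosedFieldType) (A : hopfStarAlgType C).

Lemma antipode_bilin :
  bilinear_for *:%R *:%R (fun x y : A => antipode x * y).
Proof.
split=> [y|x] k a b /=; first by rewrite linearP mulrDl scalerAl.
by rewrite mulrDr scalerAr.
Qed.

(** The matrix [S(u)] is a left inverse of [u] and [u^*] is a right inverse, so they coincide. *)
Lemma antipode_corep (I : finType) (u : I -> I -> A) :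
  corep u -> right_unitary u -> forall i j, antipode (u i j) = star (u j i).
Proof.
move=> cu uu i j.
have Su k : \sum_l antipode (u i l) * u l k = (i == k)%:R.
  rewrite -(counit_corep cu uu) -antipodel cu.
  (* Packs the lift as a linear map, so that [linear_sum] distributes it over the coproduct. *)
  pose m := GRing.isLinear.Build C (A ⊙ A) A *:%R _ (tens_lift_is_linear antipode_bilin).
  pose F : {linear A ⊙ A -> A} := HB.pack (tens_lift (fun x y : A => antipode x * y)) m.
  rewrite -[tens_lift _ _]/(F _) linear_sum.
  by apply: eq_bigr => l _; rewrite /= (tens_lift_pure _ _ antipode_bilin).
(* The middle term is the entry of [S(u) u u^*], bracketed in the two ways. *)
transitivity (\sum_k (\sum_l antipode (u i l) * u l k) * star (u j k)).
  under [RHS]eq_bigr => k _ do rewrite mulr_suml.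
  rewrite exchange_big (bigD1 j) //=.
  under eq_bigr => k _ do rewrite -mulrA.
  rewrite -mulr_sumr uu eqxx mulr1 big1 ?addr0 // => l lj.
  under eq_bigr => k _ do rewrite -mulrA.
  by rewrite -mulr_sumr uu (negPf lj) mulr0.
rewrite (bigD1 i) //= Su eqxx mul1r big1 ?addr0 // => k ki.
by rewrite Su eq_sym (negPf ki) mul0r.
Qed.

End Antipode.

(** * Antimultiplicativity of the antipode and, for Kac type, its compatibility with the
    involution *)

Section CompactQuantumGroups.
Variables (C : numClosedFieldType) (A : cqgType C).

(** Reduces linear identities on the whole algebra to coefficients of unitary corepresentations. *)
Lemma cqg_ind (P : A -> Prop) :
  (forall (I : finType) (u : I -> I -> A), corep u -> right_unitary u ->
     forall i j, P (u i j)) ->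
  P 0 -> (forall k x y, P x -> P y -> P (k *: x + y)) -> forall a, P a.
Proof.
move=> Pu P0 Plin a; have [n [u [c [[cu uu _] ->]]]] := unitary_coeff a.
have PD x y : P x -> P y -> P (x + y).
  by move=> Px Py; rewrite -[x]scale1r; apply: Plin.
apply: (big_ind P) => // i _; apply: (big_ind P) => // j _.
by rewrite -[_ *: _]addr0; apply: Plin => //; apply: (Pu _ u).
Qed.

Lemma antipodeM (a b : A) : antipode (a * b) = antipode b * antipode a.
Proof.
elim/cqg_ind: a => [I u cu uu i j||k x y hx hy].
- elim/cqg_ind: b => [J v cv uv k l||k x y hx hy].
  + have := antipode_corep (corep_prodP cu cv) (right_unitary_prod uu uv).
    move=> /(_ (i, k) (j, l)); rewrite /corep_prod /= => ->.
    by rewrite starM (antipode_corep cu) // (antipode_corep cv).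
  + by rewrite mulr0 raddf0 mul0r.
  + by rewrite mulrDr -scalerAr !linearP hx hy mulrDl scalerAl.
- by rewrite mul0r raddf0 mulr0.
- by rewrite mulrDl -scalerAl !linearP hx hy mulrDr scalerAr.
Qed.

Lemma antipode1 : antipode (1 : A) = 1.
Proof.
(* The unit is the coefficient of the trivial one-dimensional corepresentation. *)
have c1 : corep (fun _ _ : unit => 1 : A).
  by move=> i j; rewrite big_const card_unit /= addr0 rmorph1.
have u1 : right_unitary (fun _ _ : unit => 1 : A).
  by move=> [] []; rewrite big_const card_unit /= addr0 star1 mulr1.
by rewrite (antipode_corep c1 u1 tt tt) star1.
Qed.

(* By invariance, [id ⊗ haar] maps the coproduct of [\sum_k star (u i k) * u j k]
   to a scalar; traciality evaluates [\sum_k haar (star (u l k) * u m k)] to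
   [(l == m)%:R], both in this scalar and in the expansion of the coproduct. *)
Lemma right_unitary_conj (I : finType) (u : I -> I -> A) : kac_type A ->
  corep u -> right_unitary u -> right_unitary (corep_conj u).
Proof.
move=> hkac cu uu i j.
have [haar1 _] := @haar_state C A.
pose w := corep_prod (corep_conj u) u.
have cw : corep w by apply: corep_prodP => //; apply: corep_conjP.
have hw l m : \sum_k haar (w (l, m) (k, k)) = (l == m)%:R.
  rewrite /w /corep_prod /corep_conj /=.
  under eq_bigr => k _ do rewrite hkac.
  rewrite -linear_sum uu eq_sym; case: eqP => _; [exact: haar1|exact: raddf0].
transitivity (\sum_k slice_r haar (comul (w (i, j) (k, k)))); last first.
  under eq_bigr => k _ do rewrite haar_invr.
  by rewrite -scaler_suml hw; case: eqP => _; rewrite ?scale1r ?scale0r.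
under [RHS]eq_bigr => k _ do rewrite slice_r_corep //.
rewrite exchange_big /=.
under [RHS]eq_bigr => x _ do rewrite -scaler_suml.
rewrite -(pair_bigA _ (fun l m => (\sum_k haar (w (l, m) (k, k))) *: w (i, j) (l, m))) /=.
apply: eq_bigr => l _; rewrite (bigD1 l) //= hw eqxx scale1r big1 ?addr0.
  by rewrite /w /corep_prod /corep_conj /= starK.
by move=> m ml; rewrite hw eq_sym (negPf ml) scale0r.
Qed.

(** Since the conjugate of [u] is unitary too, [antipode_corep] applies to both: each side equals
    [u j i] on [u i j]. *)
Lemma antipode_star : kac_type A -> forall a : A, antipode (star a) = star (antipode a).
Proof.
move=> hkac; apply: cqg_ind => [I u cu uu i j||k x y hx hy].
- have := antipode_corep (corep_conjP cu) (right_unitary_conj hkac cu uu).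
  by move=> /(_ i j); rewrite /corep_conj => ->; rewrite (antipode_corep cu).
- by rewrite raddf0 !star0 raddf0.
- by rewrite star_antilinear !linearP /= hx hy star_antilinear.
Qed.

(** * The functional [phi_D]: positivity and idempotence *)

Fact mul_antipode_bilin : bilinear_for *:%R *:%R
  (fun (a : A) (b : cop A) => a * antipode (untilde b)).
Proof.
split=> [b|a] k x y /=; first by rewrite mulrDl scalerAl.
by rewrite -[untilde _]/(k *: untilde x + untilde y) linearP mulrDr scalerAr.
Qed.

Definition mul_antipode : A ⊙ cop A -> A :=
  tens_lift (fun (a : A) (b : cop A) => a * antipode (untilde b)).
HB.instance Definition _ := GRing.isLinear.Build C (A ⊙ cop A) A *:%R
  mul_antipode (tens_lift_is_linear mul_antipode_bilin).

Lemma mul_antipodeE (a : A) (b : cop A) : mul_antipode (a ⊗ b) = a * antipode (untilde b).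
Proof. exact: tens_lift_pure mul_antipode_bilin. Qed.

Definition diag_state (x : A ⊙ cop A) : C := haar (mul_antipode x).

Fact diag_state_linear : linear_for *%R diag_state.
Proof. by move=> k x y; rewrite /diag_state !linearP. Qed.
HB.instance Definition _ := GRing.isLinear.Build C (A ⊙ cop A) C *%R
  diag_state diag_state_linear.

Lemma diag_stateE (a b : A) : diag_state (a ⊗ tilde b) = haar (a * antipode b).
Proof. by rewrite /diag_state mul_antipodeE. Qed.

(* [haar (a^* a' S(b^* b')) = haar ((a S(b))^* (a' S(b')))], since [S] is a
   *-antimultiplicative map and [haar] is a trace. *)
Lemma diag_state_star (x y : A ⊙ cop A) : kac_type A ->
  diag_state (star x * y) =
  haar (star (mul_antipode x) * mul_antipode y).
Proof.
move=> hkac; elim/tens_ind: x => [a b|x x' hx hx']; last first.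
  by rewrite starD mulrDl !linearD /= hx hx' starD mulrDl linearD.
elim/tens_ind: y => [a' b'|y y' hy hy']; last first.
  by rewrite mulrDr !linearD /= hy hy' mulrDr linearD.
rewrite star_pure_tens pure_tensM /diag_state !mul_antipodeE.
rewrite -[untilde (star b * b')]/(star (untilde b) * untilde b').
by rewrite antipodeM antipode_star // starM mulrA hkac !mulrA.
Qed.

Lemma diag_state_is_state : kac_type A -> is_state diag_state.
Proof.
move=> hkac; have [haar1 haar_ge0] := @haar_state C A.
split=> [|x]; last by rewrite /= diag_state_star.
by rewrite tens1E -haar1 -[in RHS](mulr1 1) -[X in _ * X]antipode1; apply: diag_stateE.
Qed.

Lemma diag_state_idempotent : idempotent_functional diag_state.
Proof.
elim/tens_ind => [a b|x y hx hy]; last by rewrite !raddfD /= hx hy.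
elim/cqg_ind: a => [I u cu uu i j||k x y hx hy]; first last.
- by rewrite pure_tensDl pure_tensZl !linearP /= hx hy.
- by rewrite pure_tens0l !raddf0.
elim/cqg_ind: b => [J v cv uv k l||k x y hx hy]; first last.
- by rewrite pure_tensDr pure_tensZr !linearP /= hx hy.
- by rewrite pure_tens0r !raddf0.
have [haar1 _] := @haar_state C A.
rewrite (comul_corep_cop _ _ _ _ cu cv) [RHS]diag_stateE (antipode_corep cv) //.
(* The transposition in [antipode (v k l) = star (v l k)] undoes the flip of the co-opposite
   coproduct: both legs become coefficients of [w], namely [w (i, l) (p, q)] and
   [w (p, q) (j, k)]. *)
pose w := corep_prod u (corep_conj v).
have cw : corep w by apply: corep_prodP => //; apply: corep_conjP.
(* Left invariance of [haar] turns the value at a coefficient of [w] into the sum of products over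
   [(p, q)]. *)
have <- : haar (slice_l haar (comul (w (i, l) (j, k)))) = haar (u i j * star (v l k)).
  by rewrite haar_invl linearZ /= haar1 mulr1.
rewrite slice_l_corep // [RHS]linear_sum /=.
rewrite -[RHS](pair_bigA _ (fun p q => haar (haar (w (i, l) (p, q)) *: w (p, q) (j, k)))) /=.
rewrite linear_sum; apply: eq_bigr => p _; rewrite /= linear_sum.
apply: eq_bigr => q _; rewrite /= tens_formE /= !diag_stateE !(antipode_corep cv) //.
by rewrite linearZ.
Qed.

End CompactQuantumGroups.

Theorem proposition3p1 (R : realType) (A : cqgType R[i]) (hkac : kac_type A) :
  exists phi_D : {scalar (A ⊙ cop A)},
    [/\ forall a b : A, phi_D (a ⊗ tilde b) = haar (a * antipode b),
        forall psi : {scalar (A ⊙ cop A)},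
          (forall a b : A, psi (a ⊗ tilde b) = haar (a * antipode b)) ->
          psi =1 phi_D &
        idempotent_state phi_D].
Proof.
exists (@diag_state _ A); split.
- exact: diag_stateE.
- move=> psi psiE; elim/tens_ind => [a b|x y hx hy]; last by rewrite !raddfD /= hx hy.
  exact: etrans (psiE a b) (esym (diag_stateE a b)).
- by split; [exact: diag_state_is_state|exact: diag_state_idempotent].
Qed.
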